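(* As $n \to \infty$, $$\sum_{k=0}^n \frac{1}{k!}\binom{n}{k} = O\left(e^{2\sqrt{n}}\right).$$ In particular, the expected number of non-dominated subsets among $n$ random pairs $(l_i,r_i)$, which equals this sum, is sub-exponential in $n$.
   Context: A pair $(l_1,r_1)$ dominates $(l_2,r_2)$ if $l_1 \ge l_2$ and $r_1 \ge r_2$ with at least one of $l_1 > l_2$ or $r_1 > r_2$; a subset of pairs is non-dominated if it contains no element dominated by another element of the subset (the empty set included). The random model is: the values $l_1,\dots,l_n$ are pairwise distinct, the values $r_1,\dots,r_n$ are pairwise distinct, the family of $l_i$'s is independent of the family of $r_i$'s, and each relative ordering of the $l_i$'s is equally likely; in this model the expected number of non-dominated subsets equals $\sum_{k=0}^n \frac{1}{k!}\binom{n}{k}$. *)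

(* Defs.v *)
(* MathComp + MathComp-Analysis *)
From HB Require Import structures.
From mathcomp Require Export all_boot all_order all_algebra all_fingroup.
From mathcomp Require Export all_classical all_reals all_analysis.
Export Order.TTheory GRing.Theory Num.Theory.
Export numFieldNormedType.Exports.

Set Implicit Arguments.
Unset Strict Implicit.
Unset Printing Implicit Defensive.

Local Open Scope classical_set_scope.
Local Open Scope ring_scope.

Definition binom_fact_sum (R : realType) (n : nat) : R :=
  \sum_(0 <= k < n.+1) (k`!%:R)^-1 * 'C(n, k)%:R.

Definition dominates (R : realType) (p q : R * R) : bool :=
  [&& q.1 <= p.1, q.2 <= p.2 & (q.1 < p.1) || (q.2 < p.2)].

(* A subset of a family of pairs is represented by the set of its indices;
   for pairwise distinct pairs this is a bijection. *)
Definition nondominated (R : realType) (n : nat) (p : 'I_n -> R * R)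
    (S : {set 'I_n}) : bool :=
  [forall i in S, forall j in S, ~~ dominates (p j) (p i)].

Definition num_nondominated (R : realType) (n : nat) (p : 'I_n -> R * R) : nat :=
  #|[set S : {set 'I_n} | nondominated p S]%SET|.

(* [g_sigma_preimage X] is the sigma-algebra generated by all the [X i] jointly,
   so this is independence of the two families as random vectors; nothing is
   required inside either family. *)
Definition indep_families (R : realType) (d : measure_display)
    (T : measurableType d) (P : probability T R) (n : nat)
    (X Y : 'I_n -> {RV P >-> R}) : Prop :=
  forall A B : set T,
    g_sigma_preimage (fun i => X i : T -> R) A ->
    g_sigma_preimage (fun i => Y i : T -> R) B ->
    P (A `&` B) = (P A * P B)%E.

(* The event X_{s(0)} < X_{s(1)} < ... < X_{s(n-1)}. *)
Definition ordering_event (R : realType) (d : measure_display)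
    (T : measurableType d) (P : probability T R) (n : nat)
    (X : 'I_n -> {RV P >-> R}) (s : 'S_n) : set T :=
  [set w | forall i j : 'I_n, (i < j)%N -> X (s i) w < X (s j) w].

(* The ordering of the [r i] may have an arbitrary law. *)
Record random_pairs (R : realType) (d : measure_display)
    (T : measurableType d) (P : probability T R) (n : nat)
    (l r : 'I_n -> {RV P >-> R}) : Prop := RandomPairs {
  random_pairs_distinct_l : {ae P, forall w, injective (fun i => l i w)} ;
  random_pairs_distinct_r : {ae P, forall w, injective (fun i => r i w)} ;
  random_pairs_indep : indep_families l r ;
  random_pairs_uniform : forall s t : 'S_n,
    P (ordering_event l s) = P (ordering_event l t) }.

Definition expected_nondominated (R : realType) (d : measure_display)
    (T : measurableType d) (P : probability T R) (n : nat)
    (l r : 'I_n -> {RV P >-> R}) : \bar R :=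
  'E_P[fun w => (num_nondominated (fun i => (l i w, r i w)))%:R]%E.

(* u_n = e^{o(n)}, i.e. u grows more slowly than every exponential. *)
Definition subexponential (R : realType) (u : nat -> R) : Prop :=
  forall eps : R, 0 < eps -> u =o_\oo (fun n => expR (eps * n%:R)).

(* Main.v *)
Require Import Defs.
From mathcomp Require Import ring lra measurable_realfun.

(** The expectation is computed by linearity over the index sets [S]. When all
    coordinates are distinct, [S] is non-dominated exactly when the order of
    the [l i] on [S] is the reverse of the order of the [r i] on [S]. Once the
    ordering of the [r i] is fixed, this prescribes one of the #|S|! relative
    orders of the [l i] on [S]. These are equally likely, so [S] is
    non-dominated with probability 1 / #|S|!, and there are C(n, k) sets of
    size k. The symmetry is made precise by [card_sorts_on]: every ordering of
    all the indices becomes one with the prescribed order on [S] by exactly one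
    permutation supported by [S]. The ordering of the [r i] enters through
    weights of total mass 1 ([expected_nondominatedE]).

    For the growth, C(n, k) / k! <= n^k / k!^2 = ((sqrt n)^k / k!)^2, and a sum
    of squares of nonnegative numbers is at most the square of their sum, here
    at most exp (sqrt n). Hence the sum is at most exp (2 sqrt n), with
    constant 1 and for every n ([binom_fact_sum_le]). As sqrt n = o(n), this is
    o(exp (eps n)) for every eps > 0. *)

Set Implicit Arguments.
Unset Strict Implicit.
Unset Printing Implicit Defensive.

Local Open Scope classical_set_scope.
Local Open Scope ring_scope.

(** * Sorting by a permutation supported by a set *)

(** On [S], reading the values of [f] through [u] follows the order of [g].
    Two uses: [u] sorts [f] when [f] is the given data and [g] the position;
    [u] is a ranking compatible with [g] when [f] is the order on indices. *)
Definition sorts_on (I : finType) (R : realDomainType) (S : {set I}) (g f : I -> R)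
    (u : {perm I}) : bool :=
  [forall i in S, forall j in S, (g i < g j) ==> (f (u i) < f (u j))].

Lemma sorts_onP (I : finType) (R : realDomainType) (S : {set I}) (g f : I -> R)
    (u : {perm I}) :
  reflect {in S &, forall i j, g i < g j -> f (u i) < f (u j)}
    (sorts_on S g f u).
Proof.
apply: (iffP forall_inP) => [H i j iS jS gij | H i iS].
  by have /forall_inP/(_ j jS)/implyP/(_ gij) := H i iS.
by apply/forall_inP => j jS; apply/implyP; apply: H.
Qed.

(** The rearrangement principle: among the permutations supported by [S],
    one that maximises the sum of the [g i * f (u i)] has no inversion, because
    exchanging the values of an inverted pair would increase that sum. *)
Lemma sorts_on_exists (I : finType) (R : realDomainType) (S : {set I})
    (g f : I -> R) :
  {in S &, injective f} -> exists2 u, perm_on S u & sorts_on S g f u.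
Proof.
move=> finj; pose F (u : {perm I}) := \sum_i g i * f (u i).
case: (arg_maxP F (perm_on1 S)) => u uS umax; exists u => //.
apply/sorts_onP => i j iS jS gij; rewrite ltNge; apply/negP => fij.
have ij : i != j by apply: contraTneq gij => ->; rewrite ltxx.
have {fij}fij : f (u j) < f (u i).
  rewrite lt_neqAle fij andbT; apply: contra_neq ij => eq_uji.
  by apply: (@perm_inj _ u); apply/esym/finj; rewrite ?(perm_closed _ uS).
have vS : perm_on S (tperm i j * u)%g.
  apply: perm_onM uS; apply/fintype.subsetP => k; rewrite inE.
  by case: tpermP => [-> _|-> _|_ _ /eqP].
(* exchanging the two inverted values adds (g j - g i) (f (u i) - f (u j)) *)
have := umax _ vS; apply/negP; rewrite -ltNge /F.
rewrite (bigD1 i)//= (bigD1 j) 1?eq_sym//= [ltRHS](bigD1 i)//=.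
rewrite [in ltRHS](bigD1 j) 1?eq_sym//= !permM tpermL tpermR !addrA.
rewrite [X in _ + X < _](eq_bigr (fun k => g k * f ((tperm i j * u)%g k))).
  rewrite ltrD2r -subr_gt0 (_ : _ - _ = (g j - g i) * (f (u i) - f (u j))).
    by rewrite mulr_gt0 ?subr_gt0.
  by ring.
by move=> k /andP[ki kj]; rewrite permM tpermD// eq_sym.
Qed.

(** If two such sorts differed, each would place, at the first point where
    they disagree, a value smaller than the value placed there by the other. *)
Lemma sorts_on_unique (I : finType) (R : realDomainType) (S : {set I})
    (g f : I -> R) (u v : {perm I}) :
  {in S &, injective g} -> perm_on S u -> perm_on S v ->
  sorts_on S g f u -> sorts_on S g f v -> u = v.
Proof.
move=> ginj uS vS.
(* At a disagreement [i] of least [g], the place [j] where [a] puts the value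
   [b i] is another disagreement, hence a later one. *)
have key (a b : {perm I}) i : perm_on S a -> perm_on S b ->
    sorts_on S g f a -> i \in S -> a i != b i ->
    (forall j, j \in S -> a j != b j -> g i <= g j) -> f (a i) < f (b i).
  move=> aS bS /sorts_onP asrt iS abi imin.
  pose j := (a^-1 (b i))%g.
  have aj : a j = b i by rewrite permKV.
  have jS : j \in S by rewrite -(perm_closed _ aS) aj perm_closed.
  have ji : j != i by apply: contra_neq abi => ji; rewrite -aj ji.
  rewrite -aj; apply: asrt => //; rewrite lt_neqAle imin// ?andbT.
    by apply: contra_neq ji => /ginj ->.
  by rewrite aj; apply: contra_neq ji => /perm_inj.
move=> us vs; apply/permP => i0; apply/eqP/negPn/negP => d0.
have i0S : (i0 \in S) && (u i0 != v i0).
  rewrite d0 andbT; apply: contraNT d0 => i0S.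
  by rewrite (out_perm uS)// (out_perm vS).
case: (arg_minP (P := fun i => (i \in S) && (u i != v i)) g i0S).
move=> i /andP[iS di] imin.
have uv : f (u i) < f (v i).
  by apply: key => // j jS dj; apply: imin; rewrite jS.
suff : f (v i) < f (u i) by rewrite ltNge ltW.
by apply: key => //; rewrite 1?eq_sym// => j jS dj; apply: imin; rewrite jS eq_sym.
Qed.

Lemma sorts_on_mul (I : finType) (R : realDomainType) (S : {set I})
    (g f : I -> R) (u s : {perm I}) :
  sorts_on S g (fun i => f (s i)) u = sorts_on S g f (u * s)%g.
Proof.
by apply: eq_forallb => i; congr (_ ==> _); apply: eq_forallb => j; rewrite !permM.
Qed.

(** By symmetry the permutations split evenly among the #|S|! relative
    orders on [S]. Formally, the pairs (u, s) with [u] supported by [S] and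
    [u * s] sorting are counted twice: each [s] has exactly one such [u], and
    each [u] has as many such [s] as there are sorting permutations. *)
Lemma card_sorts_on (I : finType) (R : realDomainType) (S : {set I}) (g f : I -> R) :
  {in S &, injective g} -> injective f ->
  (#|[set u | sorts_on S g f u]%SET| * (#|S|)`!)%N = (#|I|)`!.
Proof.
move=> ginj finj.
pose c (b : bool) : nat := b.
have one (s : {perm I}) : (\sum_(u | perm_on S u) c (sorts_on S g f (u * s)%g) = 1)%N.
  have [|u uS us] := @sorts_on_exists _ _ S g (fun i => f (s i)).
    by move=> i j _ _ /finj/perm_inj.
  rewrite (bigD1 u)//= -sorts_on_mul us big1 // => v /andP[vS vu].
  rewrite -sorts_on_mul; apply/eqP; rewrite eqb0; apply: contra_neqN vu => vs.
  exact: sorts_on_unique vS uS vs us.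
have -> : (#|I|)`! = (\sum_(s : {perm I}) 1)%N.
  rewrite sum1_card -[in LHS]cardsT -card_perm; apply: eq_card => s.
  by apply/fintype.subsetP => x _; exact: finset.in_setT.
rewrite (eq_bigr _ (fun s _ => esym (one s))).
rewrite exchange_big/= -(card_perm S) mulnC -sum_nat_const.
apply: eq_bigr => u _.
rewrite (reindex_inj (mulgI u^-1%g))/= -sum1dep_card big_mkcond/=.
by apply: eq_bigr => s _; rewrite mulKVg; case: sorts_on.
Qed.

(** * Non-dominated sets of rank vectors *)

(** The position of [i] in the ordering that lists [s 0], [s 1] and so on. *)
Definition rank_of (R : realType) (n : nat) (s : 'S_n) (i : 'I_n) : R :=
  ((s^-1)%g i)%:R.

Lemma rank_of_inj (R : realType) (n : nat) (s : 'S_n) : injective (@rank_of R n s).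
Proof. by move=> i j /eqP; rewrite eqr_nat => /eqP /val_inj /perm_inj. Qed.

Lemma eq_num_nondominated (R : realType) (n : nat) (l r l' r' : 'I_n -> R) :
  (forall i j, (l i < l j) = (l' i < l' j)) ->
  (forall i j, (r i < r j) = (r' i < r' j)) ->
  num_nondominated (fun i => (l i, r i)) =
  num_nondominated (fun i => (l' i, r' i)).
Proof.
move=> ll rr; apply: eq_card => S; rewrite !inE.
apply: eq_forallb => i; congr (_ ==> _); apply: eq_forallb => j.
by congr (_ ==> ~~ _); rewrite /dominates/= !leNgt !ll !rr.
Qed.

(** On a non-dominated set the two coordinates are ordered oppositely; negating
    one of them turns this into a condition of sorting. *)
Lemma nondominated_sorts_on (R : realType) (n : nat) (s : 'S_n) (r : 'I_n -> R)
    (S : {set 'I_n}) :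
  injective r ->
  nondominated (fun i => (rank_of R s i, r i)) S =
  sorts_on S (fun i => - r i) (fun k => k%:R) (s^-1)%g.
Proof.
move=> rinj; apply/forall_inP/sorts_onP => [H i j iS jS | H i iS].
  rewrite ltrN2 => rji; have /forall_inP/(_ i iS) := H j jS.
  rewrite /dominates/= (ltW rji) rji orbT !andbT -ltNge; exact.
apply/forall_inP => j jS; apply/negP => /and3P[/= lij rij].
have [rlt _|rle] := ltP (r i) (r j).
  have := H j i jS iS; rewrite ltrN2 => /(_ rlt).
  by rewrite ltNge lij.
have /rinj -> : r i = r j by apply/eqP; rewrite eq_le rij rle.
by rewrite !ltxx.
Qed.

(** Whatever the order of the second coordinates, a fixed [S] is non-dominated for
    exactly one of the #|S|! relative orders of the first coordinates on [S],
    that is for n! / #|S|! of the n! orderings; then sum over [S]. *)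
Lemma sum_nondominated_rank (R : realType) (n : nat) (r : 'I_n -> R) :
  injective r ->
  \sum_(s : 'S_n) (num_nondominated (fun i => (rank_of R s i, r i)))%:R =
  n`!%:R * \sum_(S : {set 'I_n}) ((#|S|)`!%:R)^-1 :> R.
Proof.
move=> rinj.
have -> : \sum_(s : 'S_n) (num_nondominated (fun i => (rank_of R s i, r i)))%:R =
    \sum_(S : {set 'I_n}) (#|[set s : 'S_n |
       nondominated (fun i => (rank_of R s i, r i)) S]%SET|%:R : R).
  rewrite -!natr_sum; congr _%:R.
  under eq_bigr do rewrite /num_nondominated -sum1dep_card big_mkcond/=.
  rewrite exchange_big/=; apply: eq_bigr => S _.
  by rewrite -sum1dep_card [RHS]big_mkcond.
rewrite mulr_sumr; apply: eq_bigr => S _.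
have gi : {in S &, injective (fun i => - r i)} by move=> i j _ _ /oppr_inj/rinj.
have fi : injective (fun k : 'I_n => k%:R : R).
  by move=> i j /eqP; rewrite eqr_nat => /eqP /val_inj.
have := card_sorts_on gi fi; rewrite card_ord => <-.
rewrite natrM mulfK ?pnatr_eq0 -?lt0n ?fact_gt0//; congr _%:R.
rewrite -(card_imset _ (@invg_inj _)); apply: eq_card => u.
rewrite -[u]invgK finset.mem_imset; last exact: invg_inj.
by rewrite !inE nondominated_sorts_on.
Qed.

Lemma sum_inv_fact_card (R : realType) (n : nat) :
  \sum_(S : {set 'I_n}) ((#|S|)`!%:R)^-1 = binom_fact_sum R n.
Proof.
rewrite /binom_fact_sum big_mkord.
rewrite (partition_big (fun S : {set 'I_n} => inord #|S| : 'I_n.+1) xpredT)//=.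
apply: eq_bigr => k _.
have cE (S : {set 'I_n}) : (inord #|S| == k) = (#|S| == k).
  by rewrite -val_eqE/= inordK// ltnS -[leqRHS]card_ord max_card.
under eq_bigl do rewrite cE.
under eq_bigr => S /eqP -> do [].
have := card_draws 'I_n k; rewrite card_ord => <-.
rewrite sumr_const mulr_natr.
by congr (_ *+ _); apply: eq_card => S; rewrite !inE.
Qed.

(** The ordering events partition the sample points where the values are
    distinct, and on each of them the values compare as their ranks do. *)
Lemma ordering_exists_unique (R : realType) (n : nat) (p : 'I_n -> R) :
  injective p ->
  exists s : 'S_n, (forall i j, (p i < p j) = (rank_of R s i < rank_of R s j)) /\
    forall t : 'S_n, (forall i j : 'I_n, (i < j)%N -> p (t i) < p (t j)) <-> t = s.
Proof.
move=> pinj; pose g (i : 'I_n) : R := i%:R.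
have onT (t : 'S_n) : perm_on [set: 'I_n]%SET t.
  by apply/fintype.subsetP => i _; rewrite finset.in_setT.
have sortsE (t : 'S_n) : (forall i j : 'I_n, (i < j)%N -> p (t i) < p (t j)) <->
    sorts_on [set: 'I_n]%SET g p t.
  split=> [H|/sorts_onP H i j ij]; last first.
    by apply: H; rewrite ?finset.in_setT// ltr_nat.
  by apply/sorts_onP => i j _ _; rewrite ltr_nat; exact: H.
have [|s _ ss] := @sorts_on_exists _ R [set: 'I_n]%SET g p.
  by move=> i j _ _ /pinj.
exists s; split=> [i j|t]; last first.
  split=> [/sortsE ts|->]; last exact/sortsE.
  apply: sorts_on_unique (onT t) (onT s) ts ss.
  by move=> i j _ _ /eqP; rewrite eqr_nat => /eqP/val_inj.
have mono a b : rank_of R s a < rank_of R s b -> p a < p b.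
  rewrite ltr_nat => ab; have /sortsE/(_ _ _ ab) := ss.
  by rewrite !permKV.
have [ij|ij|/rank_of_inj ->] := ltgtP (rank_of R s i) (rank_of R s j).
- exact: mono.
- by apply/negbTE; rewrite -leNgt ltW// mono.
- by rewrite ltxx.
Qed.

(** * Measurability and expectation *)

Lemma measurable_ordering (R : realType) (d : measure_display)
    (T : measurableType d) (n : nat) (X : 'I_n -> T -> R) (s : 'S_n) :
  (forall i, measurable_fun setT (X i)) ->
  measurable [set w | forall i j : 'I_n, (i < j)%N -> X (s i) w < X (s j) w].
Proof.
move=> mX.
rewrite (_ : mkset _ = \bigcap_(ij in [set ij : 'I_n * 'I_n | (ij.1 < ij.2)%N])
    [set w | X (s ij.1) w < X (s ij.2) w]); last first.
  apply/seteqP; split=> w /= H; first by move=> [i j] /=; exact: H.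
  by move=> i j ij; exact: (H (i, j)).
apply: fin_bigcap_measurable => // -[i j] _ /=.
have := measurable_fun_ltr (mX (s i)) (mX (s j)).
by move=> /(_ measurableT [set true] I); rewrite setTI.
Qed.

(** Allows the independence of the two families to be applied to their
    orderings: the previous lemma is used with the sigma-algebra that the family
    generates, for which each [X i] is measurable. *)
Lemma g_sigma_preimage_ordering (R : realType) (T : pointedType) (n : nat)
    (X : 'I_n -> T -> R) (s : 'S_n) :
  g_sigma_preimage X
    [set w | forall i j : 'I_n, (i < j)%N -> X (s i) w < X (s j) w].
Proof.
pose G := \big[setU/set0]_(i < n)
  preimage_set_system [set: T] (X i) (measurable : set (set R)).
have := @measurable_ordering R _ (g_sigma_algebraType G) n X s.
apply => i _ B mB; apply: sub_sigma_algebra.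
by rewrite /G (bigD1 i)//=; left; exists B.
Qed.

Lemma measurable_num_nondominated (R : realType) (d : measure_display)
    (T : measurableType d) (n : nat) (l r : 'I_n -> T -> R) :
  (forall i, measurable_fun setT (l i)) ->
  (forall i, measurable_fun setT (r i)) ->
  measurable_fun setT
    (fun w => (num_nondominated (fun i => (l i w, r i w)))%:R : R).
Proof.
move=> ml mr.
pose A (S : {set 'I_n}) := [set w | nondominated (fun i => (l i w, r i w)) S].
rewrite (_ : (fun w => _) = (fun w => \sum_(S : {set 'I_n}) \1_(A S) w)); last first.
  apply/funext => w; rewrite /num_nondominated -sum1dep_card natr_sum.
  rewrite big_mkcond; apply: eq_bigr => S _; rewrite indicE.
  by case: ifPn => [h|h]; [rewrite mem_set|rewrite memNset//; exact/negP].
apply: measurable_sum => S; apply: measurable_indic.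
rewrite (_ : A S = \bigcap_(ij in [set ij : 'I_n * 'I_n | ij.1 \in S /\ ij.2 \in S])
    [set w | ~~ dominates (l ij.2 w, r ij.2 w) (l ij.1 w, r ij.1 w)]); last first.
  apply/seteqP; split=> w /=.
    by move=> /forall_inP H [i j] /= [iS jS]; have /forall_inP/(_ j jS) := H i iS.
  move=> H; apply/forall_inP => i iS; apply/forall_inP => j jS.
  exact: (H (i, j)).
apply: fin_bigcap_measurable => // -[i j] _ /=.
have : measurable_fun setT
    (fun w => ~~ [&& l i w <= l j w, r i w <= r j w &
                     (l i w < l j w) || (r i w < r j w)]).
  apply/measurable_neg/measurable_and; first exact: measurable_fun_ler.
  apply: measurable_and; first exact: measurable_fun_ler.
  by apply: measurable_or; exact: measurable_fun_ltr.
by move=> /(_ measurableT [set true] I); rewrite setTI.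
Qed.

(** Applied to the partition of the sample space into ordering events: the count
    is constant on each cell, outside a null set. *)
Lemma ae_expectation_indic_sum (R : realType) (d : measure_display)
    (T : measurableType d) (P : probability T R) (I : finType) (c : I -> R)
    (A : I -> set T) (X : T -> R) :
  (forall i, 0 <= c i) -> (forall i, measurable (A i)) ->
  measurable_fun setT X ->
  {ae P, forall w, X w = \sum_i c i * \1_(A i) w} ->
  ('E_P[X] = \sum_i (c i)%:E * P (A i))%E.
Proof.
move=> c0 mA mX XE; rewrite unlock.
have mcA i : measurable_fun setT (fun w => c i * \1_(A i) w : R).
  by apply: measurable_funM => //; exact: measurable_indic.
transitivity (\int[P]_w \sum_i (c i * \1_(A i) w)%:E)%E.
  apply: ae_eq_integral => //.
  - exact/measurable_EFinP.
  - by apply: emeasurable_sum => i; exact/measurable_EFinP.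
  - by apply: filterS XE => w /= -> _; rewrite sumEFin.
rewrite ge0_integral_sum//; last 2 first.
- by move=> i; exact/measurable_EFinP.
- by move=> i w _; rewrite lee_fin mulr_ge0.
apply: eq_bigr => i _; under eq_integral do rewrite EFinM.
rewrite ge0_integralZl_EFin//; last exact/measurable_EFinP/measurable_indic.
by rewrite integral_indic// setIT.
Qed.

(** * The expected number of non-dominated sets *)

Lemma measurable_ordering_event (R : realType) (d : measure_display)
    (T : measurableType d) (P : probability T R) (n : nat)
    (X : 'I_n -> {RV P >-> R}) (s : 'S_n) : measurable (ordering_event X s).
Proof.
apply: (@measurable_ordering _ _ _ _ (fun i => X i : T -> R)) => i.
exact: measurable_funPT.
Qed.

Lemma indic_ordering_event (R : realType) (d : measure_display)
    (T : measurableType d) (P : probability T R) (n : nat)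
    (X : 'I_n -> {RV P >-> R}) (w : T) :
  injective (fun i => X i w) ->
  exists s : 'S_n,
    (forall i j, (X i w < X j w) = (rank_of R s i < rank_of R s j)) /\
    forall t : 'S_n, \1_(ordering_event X t) w = (t == s)%:R :> R.
Proof.
move=> /ordering_exists_unique[s [sE sU]]; exists s; split => // t.
rewrite indicE; congr (_%:R); congr nat_of_bool.
by apply/idP/eqP => [|/sU ts]; [rewrite inE => /sU|rewrite inE].
Qed.

Lemma sum_ordering_event (R : realType) (d : measure_display)
    (T : measurableType d) (P : probability T R) (n : nat)
    (X : 'I_n -> {RV P >-> R}) :
  {ae P, forall w, injective (fun i => X i w)} ->
  (\sum_(s : 'S_n) P (ordering_event X s) = 1)%E.
Proof.
move=> Xinj.
have := @ae_expectation_indic_sum R d T P _ (fun=> 1) (ordering_event X) (cst 1).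
rewrite expectation_cst => ->//.
- by apply: eq_bigr => s _; rewrite mul1e.
- by move=> s; exact: measurable_ordering_event.
apply: filterS Xinj => w /indic_ordering_event[s [_ sE]].
rewrite (bigD1 s)//= sE eqxx mulr1 big1 ?addr0// => t ts.
by rewrite sE (negbTE ts) mulr0.
Qed.

Lemma ordering_event_uniform (R : realType) (d : measure_display)
    (T : measurableType d) (P : probability T R) (n : nat)
    (X : 'I_n -> {RV P >-> R}) (s : 'S_n) :
  {ae P, forall w, injective (fun i => X i w)} ->
  (forall s t : 'S_n, P (ordering_event X s) = P (ordering_event X t)) ->
  P (ordering_event X s) = ((n`!%:R)^-1)%:E.
Proof.
move=> Xinj Xunif.
have fs : P (ordering_event X s) \is a fin_num.
  by apply: fin_num_measure; exact: measurable_ordering_event.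
have := sum_ordering_event Xinj.
under eq_bigr do rewrite (Xunif _ s).
rewrite -(fineK fs) sumEFin sumr_const card_Sn => -[] h; congr EFin.
have n0 : (n`!%:R : R) != 0 by rewrite pnatr_eq0 -lt0n fact_gt0.
by apply: (mulIf n0); rewrite mulVf// mulr_natr.
Qed.

(** Almost surely the number of non-dominated subsets is [N s t], where [s]
    and [t] are the orderings of the two families. By independence and
    uniformity the expectation is the sum of N s t / n! weighted by the law of
    [t], and the sum over [s] does not depend on [t]. *)
Lemma expected_nondominatedE (R : realType) (n : nat) (d : measure_display)
    (T : measurableType d) (P : probability T R) (l r : 'I_n -> {RV P >-> R}) :
  random_pairs l r -> expected_nondominated l r = (binom_fact_sum R n)%:E.
Proof.
case=> linj rinj indep unif.
pose N (s t : 'S_n) : R :=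
  (num_nondominated (fun i => (rank_of R s i, rank_of R t i)))%:R.
rewrite /expected_nondominated (@ae_expectation_indic_sum _ _ _ _
  ('S_n * 'S_n)%type (fun st => N st.1 st.2)
  (fun st => ordering_event l st.1 `&` ordering_event r st.2)); last 4 first.
- by move=> st; exact: ler0n.
- by move=> st; apply: measurableI; exact: measurable_ordering_event.
- by apply: measurable_num_nondominated => i; exact: measurable_funPT.
- apply: filterS2 linj rinj => w.
  move=> /indic_ordering_event[s [sE sU]] /indic_ordering_event[t [tE tU]].
  rewrite (bigD1 (s, t))//= [in RHS]indicI /= sU tU !eqxx !mulr1.
  rewrite big1 ?addr0 => [|[s' t'] /= st]; last first.
    rewrite indicI/= sU tU -natrM mulnb; move: st; rewrite xpair_eqE => /negbTE ->.
    by rewrite mulr0.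
  by congr _%:R; exact: eq_num_nondominated.
rewrite -(pair_bigA _ (fun s t => (N s t)%:E *
  P (ordering_event l s `&` ordering_event r t))%E)/= exchange_big/=.
have inner (t : 'S_n) : (\sum_(s : 'S_n)
    (N s t)%:E * P (ordering_event l s `&` ordering_event r t) =
    (binom_fact_sum R n)%:E * P (ordering_event r t))%E.
  under eq_bigr => s _.
    rewrite indep; [|exact: g_sigma_preimage_ordering..].
    rewrite ordering_event_uniform// muleA -EFinM; over.
  rewrite -ge0_sume_distrl; last by move=> s _; rewrite lee_fin mulr_ge0.
  rewrite sumEFin -mulr_suml sum_nondominated_rank; last exact: rank_of_inj.
  by rewrite sum_inv_fact_card mulrAC divff ?mul1r// pnatr_eq0 -lt0n fact_gt0.
rewrite (eq_bigr _ (fun t _ => inner t)) -ge0_sume_distrr//.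
by rewrite sum_ordering_event// mule1.
Qed.

(** * Growth of the sum *)

Lemma exp_partial_sum_le (R : realType) (x : R) (n : nat) : 0 <= x ->
  \sum_(0 <= k < n) x ^+ k / k`!%:R <= expR x.
Proof.
move=> x0; apply: (@nondecreasing_cvgn_le _ (series (exp_coeff x))).
  by apply: nondecreasing_series => k _ _; exact: exp_coeff_ge0.
exact: is_cvg_series_exp_coeff.
Qed.

Lemma binom_fact_sum_ge0 (R : realType) (n : nat) : 0 <= binom_fact_sum R n.
Proof. by apply: sumr_ge0 => k _; rewrite mulr_ge0// invr_ge0. Qed.

Lemma sum_sqr_le_sqr_sum (R : realDomainType) (I : Type) (s : seq I) (a : I -> R) :
  (forall i, 0 <= a i) -> \sum_(i <- s) a i ^+ 2 <= (\sum_(i <- s) a i) ^+ 2.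
Proof.
move=> a0; elim: s => [|i s ih]; first by rewrite !big_nil expr0n.
rewrite !big_cons sqrrD -addrA lerD2l (le_trans ih)// lerDr.
by rewrite mulrn_wge0// mulr_ge0// sumr_ge0.
Qed.

Lemma ffact_le_exp (n k : nat) : (n ^_ k <= n ^ k)%N.
Proof.
elim: k => [|k ih]; first by rewrite ffactn0 expn0.
by rewrite ffactnSr expnSr leq_mul// leq_subr.
Qed.

(** Bound C(n, k) / k! by n^k / k!^2, the square of (sqrt n)^k / k!. The sum
    of these squares is at most the square of the sum, and the sum is a partial
    sum of the exponential series at sqrt n. *)
Lemma binom_fact_sum_le (R : realType) (n : nat) :
  binom_fact_sum R n <= expR (2 * Num.sqrt n%:R).
Proof.
rewrite (expRM_natl 2); set x := Num.sqrt _.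
have x0 : 0 <= x by exact: sqrtr_ge0.
apply: (@le_trans _ _ (\sum_(0 <= k < n.+1) (x ^+ k / k`!%:R) ^+ 2)).
  apply: ler_sum => k _.
  have kf : 0 < (k`!%:R : R) by rewrite ltr0n fact_gt0.
  rewrite expr_div_n -exprM mulnC exprM sqr_sqrtr// [leRHS]mulrC expr2 invfM.
  rewrite -mulrA ler_pM2l ?invr_gt0// ler_pdivlMl// mulrC -natrM -natrX ler_nat.
  by rewrite bin_ffact ffact_le_exp.
apply: le_trans (sum_sqr_le_sqr_sum _ _) _.
  by move=> k; rewrite divr_ge0// exprn_ge0.
rewrite ler_pXn2r ?nnegrE ?expR_ge0// ?exp_partial_sum_le//.
by apply: sumr_ge0 => k _; rewrite divr_ge0// exprn_ge0.
Qed.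

(** Since 2 sqrt n <= (eps / 2) n + 2 / eps, the exponent 2 sqrt n falls
    below eps n by an unbounded amount. *)
Lemma binom_fact_sum_subexponential (R : realType) :
  subexponential (binom_fact_sum R).
Proof.
move=> eps eps0; apply/eqoP => c c0.
near=> n.
rewrite ger0_norm ?binom_fact_sum_ge0// ger0_norm ?expR_ge0//.
apply: (le_trans (binom_fact_sum_le R n)).
rewrite -[c](@lnK R) ?posrE// -expRD ler_expR.
set x := Num.sqrt _.
have xx : n%:R = x ^+ 2 by rewrite sqr_sqrtr.
have linear_bound : 2 * x <= eps / 2 * n%:R + 2 / eps.
  have := sqr_ge0 (eps * x - 2); rewrite xx => h.
  rewrite -subr_ge0 (_ : _ - _ = (eps * x - 2) ^+ 2 / (2 * eps)).
    by rewrite divr_ge0// mulr_ge0// ltW.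
  by field; rewrite gt_eqF.
have slack : 2 / eps - ln c <= eps / 2 * n%:R.
  rewrite -ler_pdivrMl ?divr_gt0//.
  near: n; exact: nbhs_infty_ger.
lra.
Unshelve. all: by end_near. Qed.

Theorem theorem6 (R : realType) :
  [/\ binom_fact_sum R =O_\oo (fun n : nat => expR (2 * Num.sqrt (n%:R : R))),
      forall (n : nat) (d : measure_display) (T : measurableType d)
        (P : probability T R) (l r : 'I_n -> {RV P >-> R}),
        random_pairs l r ->
        expected_nondominated l r = (binom_fact_sum R n)%:E &
      forall (d : nat -> measure_display) (T : forall n, measurableType (d n))
        (P : forall n, probability (T n) R)
        (l r : forall n, 'I_n -> {RV (P n) >-> R}),
        (forall n, random_pairs (l n) (r n)) ->
        subexponential (fun n => fine (expected_nondominated (l n) (r n)))].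
Proof.
split.
- apply/eqO_exP; exists 1 => //; near=> n.
  rewrite mul1r ger0_norm ?binom_fact_sum_ge0// ger0_norm ?expR_ge0//.
  exact: binom_fact_sum_le.
- exact: expected_nondominatedE.
- move=> d T P l r lr.
  under eq_fun do rewrite expected_nondominatedE//.
  exact: binom_fact_sum_subexponential.
Unshelve. all: by end_near. Qed.
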